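(* Baumslag's metabelian group $BMG=\langle a,s,t\mid st=ts,\ [a,a^t],\ aa^s=a^t\rangle$ has property $R_\infty$.
   Context: Here $a^g=gag^{-1}$. For an automorphism $\varphi$ of a group $G$, elements $g,h\in G$ are $\varphi$-twisted conjugate if $xg\varphi(x)^{-1}=h$ for some $x\in G$; this is an equivalence relation whose classes are the $\varphi$-twisted conjugacy classes. $G$ has property $R_\infty$ if every $\varphi\in\mathrm{Aut}(G)$ has infinitely many $\varphi$-twisted conjugacy classes. *)

(* Defs.v *)
From HB Require Import structures.
From mathcomp Require Import all_boot.
From mathcomp Require Import boolp classical_sets cardinality.

Set Implicit Arguments.
Unset Strict Implicit.
Unset Printing Implicit Defensive.

Local Open Scope group_scope.

(* Left conjugation g * a * g^-1 and the matching commutator; MathComp's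
   [a ^ g] and [[~ x, y]] follow the right-action convention g^-1 * a * g. *)
Definition lconjg (G : baseGroupType) (a g : G) : G := g * a * g^-1.
Definition lcommg (G : baseGroupType) (x y : G) : G := x * y * x^-1 * y^-1.

Section TwistedConjugacy.
Variable G : groupType.

Definition twisted_conj (phi : G -> G) (g h : G) : Prop :=
  exists x : G, x * g * (phi x)^-1 = h.

Definition twisted_class (phi : G -> G) (g : G) : set G :=
  [set h | twisted_conj phi g h]%classic.

Definition twisted_classes (phi : G -> G) : set (set G) :=
  range (twisted_class phi).

End TwistedConjugacy.

Definition R_infty (G : groupType) : Prop :=
  forall phi : {multiplicative G -> G},
    bijective phi -> infinite_set (twisted_classes phi).

(* The letter (x, false) stands for the generator x, and (x, true) for its
   formal inverse. Words need not be reduced, so they only form a monoid with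
   an involution. *)
Definition word (X : Type) := seq (X * bool).

Section Words.
Variable X : choiceType.

Definition letterV (l : X * bool) : X * bool := (l.1, ~~ l.2).
Definition wordV (w : word X) : word X := rev (map letterV w).
Definition gen (x : X) : word X := [:: (x, false)].

Lemma wordVK : involutive wordV.
Proof.
move=> w; rewrite /wordV map_rev revK -map_comp map_id_in // => -[x b] _.
by rewrite /= /letterV /= negbK.
Qed.

Lemma wordV_cat : {morph wordV : u v / u ++ v >-> v ++ u}.
Proof. by move=> u v; rewrite /wordV map_cat rev_cat. Qed.

HB.instance Definition _ := Choice.copy (word X) (seq (X * bool)).
HB.instance Definition _ :=
  isStarMonoid.Build (word X) (@catA _) (@cat0s _) wordVK wordV_cat.

End Words.

Section Presentation.
Variables (X : choiceType) (R : seq (word X * word X)).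

(* Equality of words as elements of the group < X | l = r for (l, r) in R >. *)
Inductive pres_eq : word X -> word X -> Prop :=
| pres_refl u : pres_eq u u
| pres_sym u v : pres_eq u v -> pres_eq v u
| pres_trans v u w : pres_eq u v -> pres_eq v w -> pres_eq u w
| pres_mul u u' v v' :
    pres_eq u u' -> pres_eq v v' -> pres_eq (u * v) (u' * v')
| pres_mulgV u : pres_eq (u * u^-1) 1
| pres_rel l r : (l, r) \in R -> pres_eq l r.

Definition pres_eqb (u v : word X) : bool := `[< pres_eq u v >].

Lemma pres_eqb_refl : reflexive pres_eqb.
Proof. by move=> u; apply/asboolP/pres_refl. Qed.

Lemma pres_eqb_sym : symmetric pres_eqb.
Proof. by move=> u v; apply/asboolP/asboolP; apply: pres_sym. Qed.

Lemma pres_eqb_trans : transitive pres_eqb.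
Proof.
by move=> v u w /asboolP uv /asboolP vw; apply/asboolP/(pres_trans uv).
Qed.

Canonical pres_equiv : equiv_rel (word X) :=
  EquivRel pres_eqb pres_eqb_refl pres_eqb_sym pres_eqb_trans.

Definition presented := {eq_quot pres_equiv}%qT.
HB.instance Definition _ := Choice.on presented.

Definition pres_pi (w : word X) : presented := \pi_(presented)%qT w.

Lemma pres_piP u v : pres_pi u = pres_pi v <-> pres_eq u v.
Proof. by split=> [/eqmodP/asboolP|uv]; last exact/eqmodP/asboolP. Qed.

Lemma pres_pi_repr (u : presented) : pres_pi (repr u) = u.
Proof. exact: reprK. Qed.

Lemma pres_repr_pi w : pres_eq (repr (pres_pi w)) w.
Proof. by apply/pres_piP; rewrite pres_pi_repr. Qed.

Lemma pres_invg u v : pres_eq u v -> pres_eq u^-1 v^-1.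
Proof.
move=> uv; apply: (pres_trans (v := u^-1 * (v * v^-1))).
  rewrite -{1}[u^-1]mulg1; apply: pres_mul; first exact: pres_refl.
  exact/pres_sym/pres_mulgV.
rewrite mulgA -{2}[v^-1]mul1g; apply: pres_mul; last exact: pres_refl.
apply: (pres_trans (v := u^-1 * u)).
  by apply: pres_mul; [exact: pres_refl | exact: pres_sym].
by have := pres_mulgV u^-1; rewrite invgK.
Qed.

Definition pres_one : presented := pres_pi 1.
Definition pres_mulg (u v : presented) : presented :=
  pres_pi (repr u * repr v).
Definition pres_inv (u : presented) : presented := pres_pi (repr u)^-1.

Lemma pres_pi_mulg u v : pres_pi (u * v) = pres_mulg (pres_pi u) (pres_pi v).
Proof. by apply/pres_piP/pres_sym/pres_mul; apply: pres_repr_pi. Qed.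

Lemma pres_pi_inv u : pres_pi u^-1 = pres_inv (pres_pi u).
Proof. by apply/pres_piP/pres_sym/pres_invg/pres_repr_pi. Qed.

Lemma pres_mulgA : associative pres_mulg.
Proof.
move=> u v w; rewrite -(pres_pi_repr u) -(pres_pi_repr v) -(pres_pi_repr w).
by rewrite -!pres_pi_mulg mulgA.
Qed.

Lemma pres_mul1g : left_id pres_one pres_mulg.
Proof. by move=> u; rewrite -(pres_pi_repr u) -pres_pi_mulg mul1g. Qed.

Lemma pres_mulg1 : right_id pres_one pres_mulg.
Proof. by move=> u; rewrite -(pres_pi_repr u) -pres_pi_mulg mulg1. Qed.

Lemma pres_mulgVl : left_inverse pres_one pres_inv pres_mulg.
Proof.
move=> u; rewrite -(pres_pi_repr u) -pres_pi_inv -pres_pi_mulg; apply/pres_piP.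
by have := pres_mulgV (repr u)^-1; rewrite invgK.
Qed.

Lemma pres_mulgVr : right_inverse pres_one pres_inv pres_mulg.
Proof.
move=> u; rewrite -(pres_pi_repr u) -pres_pi_inv -pres_pi_mulg.
exact/pres_piP/pres_mulgV.
Qed.

HB.instance Definition _ := isGroup.Build presented
  pres_mulgA pres_mul1g pres_mulg1 pres_mulgVl pres_mulgVr.

Lemma pres_pi1 : pres_pi 1 = 1. Proof. by []. Qed.

Lemma pres_piM u v : pres_pi (u * v) = pres_pi u * pres_pi v.
Proof. exact: pres_pi_mulg. Qed.

Lemma pres_piV u : pres_pi u^-1 = (pres_pi u)^-1.
Proof. exact: pres_pi_inv. Qed.

End Presentation.

Variant BMG_gen := gen_a | gen_s | gen_t.
HB.instance Definition _ := gen_eqMixin BMG_gen.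
HB.instance Definition _ := gen_choiceMixin BMG_gen.

Definition BMG_rels : seq (word BMG_gen * word BMG_gen) :=
  let a := gen gen_a in let s := gen gen_s in let t := gen gen_t in
  [:: (s * t, t * s);
      (lcommg a (lconjg a t), 1);
      (a * lconjg a s, lconjg a t)].

Definition BMG : groupType := presented BMG_rels.

(* Main.v *)
From HB Require Import structures.
From mathcomp Require Import all_boot all_order all_algebra.
From mathcomp Require Import zify.
From mathcomp Require Import boolp classical_sets cardinality.
Require Import Defs.

Set Implicit Arguments.
Unset Strict Implicit.
Unset Printing Implicit Defensive.

Import Order.TTheory GRing.Theory Num.Theory.

(** The proof exhibits one homomorphism BMG -> Z, the exponent of t, that every
    automorphism phi preserves on the nose. Such a homomorphism is constant on
    each phi-twisted class, since it sends x g phi(x)^-1 to the same integer as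
    g, and it separates the powers of t; so there are infinitely many classes
    ([infinite_twisted_classes]).

    To see that phi preserves it, consider the homomorphism rho from BMG to the
    semidirect product of Q by Z, with 1 in Z acting as doubling, which sends a
    to the translation by 1, s to the identity and t to the doubling map. (If
    the normal closure of a is viewed as the ring Z[x, 1/x, 1/(1+x)], with s and
    t acting as x and 1+x, this is the specialization x = 1.) The exponent of t
    is the Z-component of rho. Let r = rho o phi, and write f for the
    translation part of r(a), and j, l for the Z-components of r(s), r(t). The
    relation a a^s = a^t forces the Z-component of r(a) to vanish and then reads
    f + 2^j f = 2^l f. If f were 0, then r would kill a, hence would have abelian
    image because s and t commute; but phi is onto, so r has the same
    non-abelian image as rho. Therefore 1 + 2^j = 2^l, whose only integer
    solution is j = 0, l = 1 ([exprz2_succ_eq_exprz2]). So rho and r have the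
    same Z-components on the three generators, hence everywhere. *)

(** * Multiplicative maps between groups *)

Section GroupMorphisms.
Local Open Scope group_scope.

(** Between groups preservation of 1 is automatic; this makes the theory of
    unital morphisms apply to merely multiplicative maps. *)
Lemma multiplicative_unital (G H : groupType) (f : {multiplicative G -> H}) :
  exists g : UMagmaMorphism.type G H, g = f :> (G -> H).
Proof.
have f1 : f 1 = 1 by apply: (mulgI (f 1)); rewrite -gmulfM !mulg1.
pose mM := isMultiplicative.Build G H f (@gmulfM _ _ f).
pose m1 := Multiplicative_isUMagmaMorphism.Build G H f f1.
pose g : UMagmaMorphism.type G H := HB.pack (f : G -> H) mM m1.
by exists g.
Qed.

Lemma gmulf_lconjg (G H : groupType) (f : UMagmaMorphism.type G H) (a g : G) :
  f (lconjg a g) = lconjg (f a) (f g).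
Proof. by rewrite /lconjg !gmulfM gmulfV. Qed.

End GroupMorphisms.

(** * Homomorphisms from a presented group *)

Section PresentedMorphisms.
Local Open Scope group_scope.
Variables (X : choiceType) (R : seq (word X * word X)) (H : groupType).

Definition letter_eval (f : X -> H) (l : X * bool) : H :=
  if l.2 then (f l.1)^-1 else f l.1.

Definition word_eval (f : X -> H) (w : word X) : H :=
  foldr (fun l h => letter_eval f l * h) 1 w.

Lemma word_evalM f (u v : word X) :
  word_eval f (u * v) = word_eval f u * word_eval f v.
Proof.
by elim: u => [|l u IHu]; [rewrite [RHS]mul1g | rewrite /= -mulgA -IHu].
Qed.

Lemma word_eval_gen f x : word_eval f (gen x) = f x.
Proof. exact: mulg1. Qed.

Lemma word_evalV f (w : word X) : word_eval f w^-1 = (word_eval f w)^-1.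
Proof.
elim: w => [|l w IHw]; first by rewrite [RHS]invg1.
rewrite -[l :: w]/(([:: l] : word X) * (w : word X)) invgM.
rewrite !word_evalM IHw invgM /= !mulg1; congr (_ * _).
by case: l => x [] //=; rewrite /letter_eval /= invgK.
Qed.

Lemma word_eval_pres_eq f :
    (forall l r, (l, r) \in R -> word_eval f l = word_eval f r) ->
  forall u v, pres_eq R u v -> word_eval f u = word_eval f v.
Proof.
move=> fR u v; elim=> {u v} // [v u w _ -> _ -> //|u u' v v' _ IHu _ IHv|u].
  by rewrite !word_evalM IHu IHv.
by rewrite word_evalM word_evalV mulgV.
Qed.

Lemma presented_lift f :
    (forall l r, (l, r) \in R -> word_eval f l = word_eval f r) ->
  exists h : UMagmaMorphism.type (presented R) H,
    forall x, h (pres_pi R (gen x)) = f x.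
Proof.
move=> fR; pose h (u : presented R) := word_eval f (repr u).
have hE w : h (pres_pi R w) = word_eval f w.
  by apply: word_eval_pres_eq fR _ _ _; apply: pres_repr_pi.
have hM : {morph h : u v / u * v}.
  move=> u v; rewrite -(pres_pi_repr u) -(pres_pi_repr v) -pres_piM !hE.
  exact: word_evalM.
have h1 : h 1 = 1 by rewrite -(pres_pi1 R) hE.
pose mM := isMultiplicative.Build (presented R) H h hM.
pose m1 := Multiplicative_isUMagmaMorphism.Build (presented R) H h h1.
pose hh : UMagmaMorphism.type (presented R) H := HB.pack h mM m1.
by exists hh => x; rewrite -[LHS]/(h _) hE word_eval_gen.
Qed.

End PresentedMorphisms.

Section PresentedInduction.
Local Open Scope group_scope.
Variables (X : choiceType) (R : seq (word X * word X)).

Lemma presented_ind (P : presented R -> Prop) :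
    P 1 -> (forall u v, P u -> P v -> P (u * v)) ->
    (forall u, P u -> P u^-1) -> (forall x, P (pres_pi R (gen x))) ->
  forall u, P u.
Proof.
move=> P1 PM PV Pg u; rewrite -(pres_pi_repr u).
elim: (repr u) => [|[x b] w IHw] //.
rewrite -[(x, b) :: w]/(([:: (x, b)] : word X) * (w : word X)) pres_piM.
apply: PM => //; case: b; last exact: Pg.
by rewrite -[[:: _]]/((gen x)^-1) pres_piV; apply: PV.
Qed.

(** Commuting with a fixed element is a condition closed under products and
    inverses, so commutativity extends from generators one variable at a time. *)
Lemma presented_abelian_image (H : groupType)
    (h : UMagmaMorphism.type (presented R) H) :
    (forall x y, commute (h (pres_pi R (gen x))) (h (pres_pi R (gen y)))) ->
  forall u v, commute (h u) (h v).
Proof.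
move=> hC; have hCgen y u : commute (h u) (h (pres_pi R (gen y))).
  elim/presented_ind: u => [|u v Cu Cv|u Cu|x].
  - by rewrite gmulf1; apply/commute_sym/commute1.
  - by rewrite gmulfM; apply/commute_sym/commuteM; apply: commute_sym.
  - by rewrite gmulfV; apply/commute_sym/commuteV/commute_sym.
  - exact: hC.
move=> u v; elim/presented_ind: v => [|v w Cv Cw|v Cv|x].
- by rewrite gmulf1; apply: commute1.
- by rewrite gmulfM; apply: commuteM.
- by rewrite gmulfV; apply: commuteV.
- exact: hCgen.
Qed.

End PresentedInduction.

(** * The semidirect product of the rationals by a doubling map *)

Section DoublingGroup.
Local Open Scope ring_scope.

(** The pair (b, n) stands for the affine map z |-> 2^n z + b of the rational
    line; keeping n itself, rather than the slope 2^n, makes the linear part an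
    integer that can be read off directly. *)
Definition doubling_group : Type := (rat * int)%type.
HB.instance Definition _ := Choice.copy doubling_group (rat * int)%type.

Definition dbl_mul (x y : doubling_group) : doubling_group :=
  (x.1 + 2 ^ x.2 * y.1, x.2 + y.2).
Definition dbl_one : doubling_group := (0, 0).
Definition dbl_inv (x : doubling_group) : doubling_group :=
  (- (2 ^ (- x.2) * x.1), - x.2).

Lemma dbl_mulA : associative dbl_mul.
Proof.
move=> [b m] [c n] [d k]; rewrite /dbl_mul /= expfzDr // mulrDr !addrA.
by rewrite mulrA.
Qed.

Lemma dbl_mul1x : left_id dbl_one dbl_mul.
Proof. by move=> [b n]; rewrite /dbl_mul /= expr0z mul1r !add0r. Qed.

Lemma dbl_mulx1 : right_id dbl_one dbl_mul.
Proof. by move=> [b n]; rewrite /dbl_mul /= mulr0 !addr0. Qed.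

Lemma dbl_mulVx : left_inverse dbl_one dbl_inv dbl_mul.
Proof. by move=> [b n]; rewrite /dbl_mul /= !addNr. Qed.

Lemma dbl_mulxV : right_inverse dbl_one dbl_inv dbl_mul.
Proof.
move=> [b n]; rewrite /dbl_mul /= mulrN mulrA -expfzDr // subrr expr0z mul1r.
by rewrite subrr.
Qed.

HB.instance Definition _ := isGroup.Build doubling_group
  dbl_mulA dbl_mul1x dbl_mulx1 dbl_mulVx dbl_mulxV.

Lemma dbl_mulE (x y : doubling_group) :
  (x * y)%g = (x.1 + 2 ^ x.2 * y.1, x.2 + y.2) :> doubling_group.
Proof. by []. Qed.

Lemma dbl_invE (x : doubling_group) :
  (x^-1)%g = (- (2 ^ (- x.2) * x.1), - x.2) :> doubling_group.
Proof. by []. Qed.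

(** Translations commute with each other, so only the linear part of g acts. *)
Lemma lconjg_translation (b : rat) (g : doubling_group) :
  lconjg ((b, 0) : doubling_group) g = (2 ^ g.2 * b, 0).
Proof.
rewrite /lconjg dbl_invE !dbl_mulE /= addr0 subrr.
by rewrite mulrN mulrA -expfzDr // subrr expr0z mul1r addrC addKr.
Qed.

End DoublingGroup.

(** * An exponential equation *)

Section PowersOfTwo.
Local Open Scope ring_scope.

Lemma expn2_succ_eq_expn2 (n m : nat) :
  (2 ^ n + 1 = 2 ^ m)%N -> n = 0%N /\ m = 1%N.
Proof.
case: n m => [|n] [|[|m]] //; rewrite ?expnS ?expn0; lia.
Qed.

Lemma exprz2_ge1 (m : int) : (1 <= 2 ^ m :> rat) -> exists n : nat, m = n.
Proof.
case: m => n; first by exists n.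
by rewrite NegzE -invr_expz -exprnP leNgt invf_lt1 ?exprn_gt0 // exprn_egt1.
Qed.

Lemma exprz2_succ_eq_exprz2 (j l : int) :
  1 + 2 ^ j = 2 ^ l :> rat -> j = 0 /\ l = 1.
Proof.
have nat_case (n : nat) (m : int) : 1 + 2 ^+ n = 2 ^ m :> rat -> n = 0%N /\ m = 1.
  move=> eq_nm; have [|k Dm] := @exprz2_ge1 m.
    by rewrite -eq_nm lerDl exprn_ge0.
  have : ((2 ^ n + 1)%N%:R = (2 ^ k)%N%:R :> rat).
    by rewrite natrD !natrX addrC eq_nm Dm.
  move/eqP; rewrite eqr_nat => /eqP/expn2_succ_eq_expn2[-> Dk].
  by rewrite Dm Dk.
case: j => n eq_jl; first by have [-> ->] := nat_case _ _ eq_jl.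
(* For j = - (n + 1), multiplying through by 2^(n+1) makes all terms integral;
   the integral case then gives n + 1 = 0, which is absurd. *)
have [] // := nat_case n.+1 (l + n.+1%:Z).
rewrite expfzDr // -eq_jl NegzE mulrDl mul1r -expfzDr // addNr expr0z.
by rewrite addrC.
Qed.

End PowersOfTwo.

(** * Detecting infinitely many twisted classes *)

Section TwistedInvariants.
Local Open Scope group_scope.

(** An invariant of twisted conjugacy descends to the set of twisted classes,
    which is then at least as large as its set of values. The condition
    phi 1 = 1 makes each element a member of its own class. *)
Lemma infinite_twisted_classes (G : groupType) (T : Type) (phi : G -> G)
    (F : G -> T) (g : nat -> G) :
    (forall x h, F (x * h * (phi x)^-1) = F h) -> injective (F \o g) ->
    phi 1 = 1 ->
  infinite_set (twisted_classes phi).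
Proof.
move=> Finv Fg_inj phi1 fin_cl; apply: infinite_nat.
pose cl n := twisted_class phi (g n).
have cl_inj : injective cl.
  move=> m n eq_cl; apply: Fg_inj => /=.
  have: cl n (g n) by exists 1; rewrite phi1 invg1 mulg1 mul1g.
  by rewrite -eq_cl => -[x <-]; rewrite Finv.
have := finite_preimage (f := cl) (fun m n _ _ => @cl_inj m n) fin_cl.
by apply: sub_finite_set => n _; exists (g n).
Qed.

End TwistedInvariants.

(** * Baumslag's group *)

Section BaumslagGroup.

Local Notation bmg x := (pres_pi BMG_rels (gen x) : BMG).

Lemma BMG_rel_st : (bmg gen_s * bmg gen_t = bmg gen_t * bmg gen_s)%g.
Proof.
by rewrite -!pres_piM; apply/pres_piP/pres_rel; rewrite !in_cons !eqxx ?orbT.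
Qed.

Lemma BMG_rel_ast :
  (bmg gen_a * lconjg (bmg gen_a) (bmg gen_s) = lconjg (bmg gen_a) (bmg gen_t))%g.
Proof.
have pi_lconjg (u v : word BMG_gen) : pres_pi BMG_rels (lconjg u v)
    = lconjg (pres_pi BMG_rels u) (pres_pi BMG_rels v).
  by rewrite /lconjg !pres_piM pres_piV.
rewrite -!pi_lconjg -pres_piM.
by apply/pres_piP/pres_rel; rewrite !in_cons !eqxx ?orbT.
Qed.

Local Open Scope ring_scope.

(** The homomorphism rho. Once s acts trivially, the relation a a^s = a^t says
    that t doubles a, so BMG maps onto a Baumslag-Solitar group BS(1,2). *)
Lemma BMG_doubling_rep : exists rho : UMagmaMorphism.type BMG doubling_group,
  [/\ rho (bmg gen_a) = (1, 0), rho (bmg gen_s) = (0, 0)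
    & rho (bmg gen_t) = (0, 1)].
Proof.
pose f x : doubling_group :=
  match x with gen_a => (1, 0) | gen_s => (0, 0) | gen_t => (0, 1) end.
have [l r|rho rhoE] := @presented_lift BMG_gen BMG_rels doubling_group f.
  rewrite !inE => /or3P[] /eqP[-> ->]; by apply/eqP; vm_compute.
by exists rho; rewrite !rhoE.
Qed.

(** Non-commutativity of the image is what excludes the degenerate case where
    r(a) is trivial; otherwise the translation part of r(a) cancels from the
    relation a a^s = a^t, leaving an equation between powers of 2. *)
Lemma BMG_nonabelian_rep (r : UMagmaMorphism.type BMG doubling_group) :
    ~ (forall u v, commute (r u) (r v)) ->
  [/\ (r (bmg gen_a)).2 = 0, (r (bmg gen_s)).2 = 0 & (r (bmg gen_t)).2 = 1].
Proof.
move=> r_nab; have r_st : commute (r (bmg gen_s)) (r (bmg gen_t)).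
  exact: gmulf_commute BMG_rel_st.
have r_ast : (r (bmg gen_a) * lconjg (r (bmg gen_a)) (r (bmg gen_s))
              = lconjg (r (bmg gen_a)) (r (bmg gen_t)))%g.
  by rewrite -!gmulf_lconjg -gmulfM BMG_rel_ast.
case Da: (r (bmg gen_a)) r_ast => [f i] r_ast.
have i0 : i = 0.
  move: (congr1 snd r_ast); rewrite /lconjg !(dbl_mulE, dbl_invE) /=; lia.
rewrite {}i0 in Da r_ast *; move: r_ast.
rewrite !lconjg_translation dbl_mulE /= expr0z mul1r => /(congr1 fst) /= eq_f.
have [f0|f_neq0] := eqVneq f 0.
  case: r_nab; apply: presented_abelian_image.
  have ra1 : r (bmg gen_a) = 1%g by rewrite Da f0.
  move=> [] []; rewrite ?ra1 //;
    by [exact: commute1 | exact/commute_sym/commute1 | exact: commute_sym].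
have [] // := @exprz2_succ_eq_exprz2 (r (bmg gen_s)).2 (r (bmg gen_t)).2.
by apply: (mulIf f_neq0); rewrite -eq_f mulrDl mul1r.
Qed.

Lemma BMG_linear_part_unique (r r' : UMagmaMorphism.type BMG doubling_group) :
    ~ (forall u v, commute (r u) (r v)) ->
    ~ (forall u v, commute (r' u) (r' v)) ->
  forall g, (r g).2 = (r' g).2.
Proof.
move=> /BMG_nonabelian_rep[ra rs rt] /BMG_nonabelian_rep[ra' rs' rt'] g.
elim/presented_ind: g => [|u v IHu IHv|u IHu|[]].
- by rewrite !gmulf1.
- by rewrite !gmulfM !dbl_mulE /= IHu IHv.
- by rewrite !gmulfV !dbl_invE /= IHu.
- by rewrite ra ra'.
- by rewrite rs rs'.
- by rewrite rt rt'.
Qed.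

End BaumslagGroup.

Theorem theorem5p3 : R_infty BMG.
Proof.
move=> phi0; have [phi <-] := multiplicative_unital phi0.
move=> [psi _ psiK]; have [rho [rho_a _ rho_t]] := BMG_doubling_rep.
have rho_nab : ~ (forall u v, commute (rho u) (rho v)).
  move/(_ (pres_pi _ (gen gen_a)) (pres_pi _ (gen gen_t))).
  by rewrite /commute rho_a rho_t => /eqP; vm_compute.
pose r : UMagmaMorphism.type BMG doubling_group := rho \o phi.
have r_nab : ~ (forall u v, commute (r u) (r v)).
  by move=> rC; apply: rho_nab => u v; rewrite -[u]psiK -[v]psiK; apply: rC.
have tau_phi g : ((rho (phi g)).2 = (rho g).2)%R.
  exact: BMG_linear_part_unique r_nab rho_nab g.
pose t : BMG := pres_pi _ (gen gen_t).
apply: (@infinite_twisted_classes _ _ _ (fun g => (rho g).2) (fun n => t ^+ n)%g).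
- move=> x h; rewrite !gmulfM gmulfV !dbl_mulE dbl_invE /= tau_phi.
  by rewrite addrAC subrr add0r.
- have tauX n : ((rho (t ^+ n)%g).2 = n%:Z)%R.
    elim: n => [|n IHn]; first by rewrite gmulf1.
    by rewrite expgS gmulfM dbl_mulE /= IHn rho_t /= -natz; lia.
  by move=> m n /=; rewrite !tauX => -[].
- exact: gmulf1.
Qed.
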